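(* Let $R$ be a $G$-rack. Then the following statements are equivalent: (1) $\mathcal{R}(R)$ is a Boolean algebra; (2) $\mathcal{R}(R)$ is modular; (3) $\mathcal{R}(R)$ is relatively complemented; (4) $\mathcal{R}(R)$ is orthocomplemented.
   Context: A rack is a set $R$ with a binary operation $\triangleright$ such that $a\triangleright(b\triangleright c)=(a\triangleright b)\triangleright(a\triangleright c)$ for all $a,b,c\in R$, and for all $a,b\in R$ there is a unique $x\in R$ with $a\triangleright x=b$. A subrack is a subset $Q$ with $(Q,\triangleright)$ a rack (including $\emptyset$); $\ll S\gg$ is the intersection of all subracks containing $S$. $\mathcal{R}(R)$ is the lattice of subracks ordered by inclusion (meet = intersection, join = $\ll Q\cup Q'\gg$, bottom $\emptyset$, top $R$). For $a\in R$, $f_a(b)=a\triangleright b$; $\mathrm{Inn}(R)$ is the group generated by the $f_a$, and the orbits of $R$ are the orbits of $\mathrm{Inn}(R)$ on $R$. $R$ is a $G$-rack if $R$ is the only subrack of $R$ meeting every orbit of $R$. A lattice is a Boolean algebra if it is complemented and distributive; modular if $a\wedge(c\vee b)=(a\wedge c)\vee b$ whenever $b\le a$; relatively complemented if every interval $[x,y]$ is complemented. A lattice $L$ is orthocomplemented if it is complemented and there is a function $\phi:L\to L$ with $\phi^2=\mathrm{id}$, $\phi(x)$ a complement of $x$ for all $x$, and $\phi(y)\le\phi(x)$ whenever $x\le y$. *)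

(* Defs.v *)
From HB Require Import structures.
From mathcomp Require Import all_boot all_order.
From mathcomp Require Import boolp classical_sets.

Set Implicit Arguments.
Unset Strict Implicit.
Unset Printing Implicit Defensive.

Import Order.TTheory.

Declare Scope rack_scope.
Delimit Scope rack_scope with rack.
Reserved Notation "a ▷ b" (at level 40, no associativity).

(* The carrier is an arbitrary type: it may be infinite, and it may be empty. *)
HB.mixin Record isRack (T : Type) := {
  rack_op : T -> T -> T;
  rack_opD : forall a b c,
    rack_op a (rack_op b c) = rack_op (rack_op a b) (rack_op a c);
  rack_op_ex1 : forall a b, exists! x, rack_op a x = b
}.

#[short(type="rackType")]
HB.structure Definition Rack := {T of isRack T}.

Notation "a ▷ b" := (rack_op a b) : rack_scope.
Local Open Scope rack_scope.
Local Open Scope classical_set_scope.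

Section RackTheory.
Variable R : rackType.
Implicit Types (a b x : R) (Q : set R).

(* (Q, ▷) is itself a rack. Closure under ▷ alone would not suffice when R is
   infinite: the solution of a ▷ x = b has to lie in Q. *)
Definition is_subrack Q : Prop :=
  [/\ forall a b, Q a -> Q b -> Q (a ▷ b),
      forall a b c, Q a -> Q b -> Q c -> a ▷ (b ▷ c) = (a ▷ b) ▷ (a ▷ c) &
      forall a b, Q a -> Q b -> exists! x, Q x /\ a ▷ x = b].

(* The subgroup of the symmetric group of R generated by the left translations
   [rack_op a]; inn_inv says that the inverse of a member is a member. *)
Inductive Inn : set (R -> R) :=
| inn_gen a : Inn (rack_op a)
| inn_id : Inn id
| inn_comp g h : Inn g -> Inn h -> Inn (g \o h)
| inn_inv g h : Inn g -> cancel g h -> cancel h g -> Inn h.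

Definition rack_orbit a : set R := [set g a | g in Inn].

Definition G_rack : Prop :=
  forall Q, is_subrack Q -> (forall a, Q `&` rack_orbit a !=set0) -> Q = setT.

Lemma rack_op_inj a : injective (rack_op a).
Proof.
move=> x y xy; have [z [_ zu]] := rack_op_ex1 a (a ▷ y).
by rewrite -(zu _ xy) -(zu _ erefl).
Qed.

Lemma is_subrackE Q : is_subrack Q <->
  (forall a b, Q a -> Q b -> Q (a ▷ b)) /\
  (forall a x, Q a -> Q (a ▷ x) -> Q x).
Proof.
split=> [[Qop _ Qdiv]|[Qop Qdiv]].
  by split=> // a x Qa /(Qdiv _ _ Qa)[y [[Qy /rack_op_inj <-]]].
split=> // [a b c _ _ _|a b Qa Qb]; first exact: rack_opD.
have [x [axb xu]] := rack_op_ex1 a b; exists x; split=> [|y [_ ayb]].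
  by split=> //; apply: (Qdiv a) => //; rewrite axb.
exact: xu.
Qed.

Lemma is_subrack0 : is_subrack set0.
Proof. by apply/is_subrackE. Qed.

Lemma is_subrackT : is_subrack setT.
Proof. by apply/is_subrackE. Qed.

Lemma is_subrack_bigcap I (D : set I) (F : I -> set R) :
  (forall i, D i -> is_subrack (F i)) -> is_subrack (\bigcap_(i in D) F i).
Proof.
move=> Fsub; apply/is_subrackE; split=> [a b Fa Fb|a x Fa Fax] i Di.
  by have /is_subrackE[+ _] := Fsub i Di; apply; [apply: Fa|apply: Fb].
by have /is_subrackE[_ +] := Fsub i Di; apply; [apply: Fa|apply: Fax].
Qed.

Lemma is_subrackI Q Q' : is_subrack Q -> is_subrack Q' -> is_subrack (Q `&` Q').
Proof.
move=> /is_subrackE[Qop Qdiv] /is_subrackE[Q'op Q'div]; apply/is_subrackE.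
split=> [a b [Qa Q'a] [Qb Q'b]|a x [Qa Q'a] [Qax Q'ax]]; split.
- exact: Qop.
- exact: Q'op.
- exact: (Qdiv a).
- exact: (Q'div a).
Qed.

Definition subrack_gen (S : set R) : set R := smallest is_subrack S.

Lemma is_subrack_gen S : is_subrack (subrack_gen S).
Proof. by apply: is_subrack_bigcap => Q []. Qed.

Record subrack := Subrack {
  subrack_set :> set R;
  subrackP : is_subrack subrack_set
}.

Lemma subrack_inj : injective subrack_set.
Proof. by move=> [Q Qp] [Q' Q'p] /= QQ'; subst Q'; congr Subrack. Qed.

HB.instance Definition _ := gen_eqMixin subrack.
HB.instance Definition _ := gen_choiceMixin subrack.

Definition subrack_le (A B : subrack) : bool := `[< A `<=` B >].
Definition subrack_meet (A B : subrack) : subrack :=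
  Subrack (is_subrackI (subrackP A) (subrackP B)).
Definition subrack_join (A B : subrack) : subrack :=
  Subrack (is_subrack_gen (A `|` B)).
Definition subrack_bot : subrack := Subrack is_subrack0.
Definition subrack_top : subrack := Subrack is_subrackT.

Fact subrack_display : Order.disp_t. Proof. exact: Order.Disp tt tt. Qed.

Fact subrack_le_refl : reflexive subrack_le.
Proof. by move=> A; apply/asboolP. Qed.

Fact subrack_le_anti : antisymmetric subrack_le.
Proof.
move=> A B /andP[/asboolP AB /asboolP BA].
by apply: subrack_inj; apply/seteqP.
Qed.

Fact subrack_le_trans : transitive subrack_le.
Proof.
move=> B A C /asboolP AB /asboolP BC.
by apply/asboolP; apply: subset_trans BC.
Qed.

HB.instance Definition _ := Order.Le_isPOrder.Build subrack_display subrack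
  subrack_le_refl subrack_le_anti subrack_le_trans.

Fact subrack_lexI (A B C : subrack) :
  (A <= subrack_meet B C)%O = (A <= B)%O && (A <= C)%O.
Proof.
apply/asboolP/andP => [ABC|[/asboolP AB /asboolP AC] x Ax].
  by split; apply/asboolP => x /ABC [].
by split; [apply: AB|apply: AC].
Qed.

Fact subrack_leUx (A B C : subrack) :
  (subrack_join A B <= C)%O = (A <= C)%O && (B <= C)%O.
Proof.
apply/asboolP/andP => [ABC|[/asboolP AC /asboolP BC]].
  by split; apply/asboolP => x ?; apply: ABC; apply: sub_gen_smallest;
    [left|right].
by apply: smallest_sub; [apply: subrackP|rewrite subUset].
Qed.

HB.instance Definition _ :=
  Order.POrder_isMeetSemilattice.Build subrack_display subrack subrack_lexI.
HB.instance Definition _ :=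
  Order.POrder_isJoinSemilattice.Build subrack_display subrack subrack_leUx.

Fact subrack_le0x (A : subrack) : (subrack_bot <= A)%O.
Proof. by apply/asboolP. Qed.

Fact subrack_lex1 (A : subrack) : (A <= subrack_top)%O.
Proof. by apply/asboolP. Qed.

HB.instance Definition _ :=
  Order.hasBottom.Build subrack_display subrack subrack_le0x.
HB.instance Definition _ :=
  Order.hasTop.Build subrack_display subrack subrack_lex1.

Lemma leEsubrack (A B : subrack) : (A <= B)%O = `[< A `<=` B >].
Proof. by []. Qed.

Lemma meetEsubrack (A B : subrack) : (A `&` B)%O = A `&` B :> set R.
Proof. by []. Qed.

Lemma joinEsubrack (A B : subrack) : (A `|` B)%O = subrack_gen (A `|` B) :> set R.
Proof. by []. Qed.

Lemma botEsubrack : (\bot : subrack)%O = set0 :> set R.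
Proof. by []. Qed.

Lemma topEsubrack : (\top : subrack)%O = setT :> set R.
Proof. by []. Qed.

End RackTheory.

Section LatticeProperties.
Context {d : Order.disp_t}.
Variable L : tbLatticeType d.
Local Open Scope order_scope.
Implicit Types a b c x y z w : L.

Definition is_complement x y : Prop := x `&` y = \bot /\ x `|` y = \top.

Definition complemented : Prop := forall x, exists y, is_complement x y.

Definition distributive_lattice : Prop :=
  right_distributive (@Order.meet d L) (@Order.join d L).

Definition boolean_algebra : Prop := complemented /\ distributive_lattice.

Definition modular : Prop :=
  forall a b c, b <= a -> a `&` (c `|` b) = (a `&` c) `|` b.

Definition relatively_complemented : Prop :=
  forall x y, x <= y -> forall z, x <= z <= y ->
    exists w, [/\ x <= w <= y, z `&` w = x & z `|` w = y].

Definition orthocomplemented : Prop :=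
  complemented /\
  exists phi : L -> L,
    [/\ forall x, phi (phi x) = x,
        forall x, is_complement x (phi x) &
        forall x y, x <= y -> phi y <= phi x].

End LatticeProperties.

(* Main.v *)
Require Import Defs.
From mathcomp Require Import all_boot all_order.
From mathcomp Require Import boolp classical_sets.

Set Implicit Arguments.
Unset Strict Implicit.
Unset Printing Implicit Defensive.

Import Order.TTheory.
Local Open Scope rack_scope.
Local Open Scope classical_set_scope.

(** In a G-rack each of the four properties forces every subrack to be a union
    of orbits, and then the lattice of subracks is a field of sets.  Let [Q] be
    a nonempty subrack contained in an orbit [O], and let [C] be the complement
    of [O], again a subrack.
    - Modularity: [Q ∨ C = R] since [Q ∪ C] meets every orbit, whence
      [O = O ∧ (C ∨ Q) = (O ∧ C) ∨ Q = Q].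
    - Relative complements: a complement [W] of [O] in [[Q, R]] meets [O], and
      also every other orbit since [O ∨ W = R]; hence [W = R] and [Q = O].
    - Orthocomplement [φ]: [φ Q ⊇ φ O] meets every orbit but [O], so it misses
      [O] because [φ Q ≠ R]. Thus [φ Q ≤ C], i.e. [φ C ≤ Q], and [φ C] is the
      least nonempty subrack of [O]. Left translations are automorphisms
      preserving [O], so they preserve [φ C], which is therefore all of [O]. *)

(** * Orbits and translation-invariant sets *)

Section Orbits.
Variable R : rackType.
Implicit Types (a b x y : R) (S : set R) (A B Q W : subrack R).

(** The equivalence covers inverse translations too, so these sets are the unions of orbits. *)
Definition translation_invariant S : Prop := forall a x, S (a ▷ x) <-> S x.

Lemma translation_invariant_subrack S : translation_invariant S -> is_subrack S.
Proof.
move=> invS; apply/is_subrackE.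
by split=> [a b _ /invS Sab|a x _ /invS Sx]; [apply: Sab|].
Qed.

Lemma translation_invariantC S :
  translation_invariant S -> translation_invariant (~` S).
Proof. by move=> invS a x; split=> nS Sx; apply: nS; apply/(invS a). Qed.

Lemma translation_invariant_Inn S g x :
  translation_invariant S -> Inn g -> S (g x) <-> S x.
Proof.
move=> invS Ig; elim: Ig x => [a||{}g h _ IHg _ IHh|{}g h _ IHg gK hK] x /=.
- exact: invS.
- by [].
- by rewrite IHg IHh.
- by rewrite -{2}(hK x) IHg.
Qed.

Lemma rack_orbit_refl a : rack_orbit a a.
Proof. by exists id => //; apply: inn_id. Qed.

Lemma translation_invariant_orbit a : translation_invariant (rack_orbit a).
Proof.
move=> b x; split=> [[g Ig gabx]|[g Ig <-]]; last first.
  by exists (rack_op b \o g) => //; apply: inn_comp => //; apply: inn_gen.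
(* [inn_inv] asks for the inverse of translation by [b] as a function; choice supplies it. *)
have /choice[h hK] y : exists z, b ▷ z = y.
  by have [z [bz _]] := rack_op_ex1 b y; exists z.
have Kh : cancel (rack_op b) h by move=> z; apply: (@rack_op_inj _ b).
exists (h \o g) => /=; last by rewrite gabx Kh.
by apply: inn_comp => //; apply: inn_inv hK; [apply: inn_gen|].
Qed.

Lemma orbit_sub_invariant S x :
  translation_invariant S -> S x -> rack_orbit x `<=` S.
Proof. by move=> invS Sx _ [g Ig <-]; apply/(translation_invariant_Inn x invS Ig). Qed.

Lemma rack_orbit_sub a x y :
  rack_orbit a y -> rack_orbit x y -> rack_orbit x `<=` rack_orbit a.
Proof.
have inva := @translation_invariant_orbit a.
move=> ay [g Ig gxy]; apply: orbit_sub_invariant => //.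
by apply/(translation_invariant_Inn x inva Ig); rewrite gxy.
Qed.

Definition orbit_subrack x : subrack R :=
  Subrack (translation_invariant_subrack (@translation_invariant_orbit x)).

Definition coorbit_subrack x : subrack R :=
  Subrack (translation_invariant_subrack
    (translation_invariantC (@translation_invariant_orbit x))).

Lemma subrack_lP A B : reflect (A `<=` B) (A <= B)%O.
Proof. exact: asboolP. Qed.

Lemma subrack_botP A : reflect (A = set0 :> set R) (A == \bot)%O.
Proof.
by apply: (iffP eqP) => [->|A0]; [|apply: subrack_inj; rewrite A0].
Qed.

(** Otherwise [A] and [B], hence their join, lie in the proper subrack [coorbit_subrack a]. *)
Lemma join_top_meets_orbit A B a :
  (A `|` B = \top)%O -> exists2 y, rack_orbit a y & subrack_set A y \/ subrack_set B y.
Proof.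
move=> AB1; apply: contrapT => noy.
have : (A `|` B <= coorbit_subrack a)%O.
  by rewrite leUx; apply/andP; split; apply/subrack_lP => y Xy ay;
    apply: noy; exists y => //; [left|right].
rewrite AB1 => /subrack_lP/(_ a I); apply.
exact: rack_orbit_refl.
Qed.

Lemma G_rack_subrack_top W :
  G_rack R -> (forall a, exists2 y, rack_orbit a y & subrack_set W y) -> W = \top%O.
Proof.
move=> hR Wmeets; apply: subrack_inj; apply: hR; first exact: subrackP.
by move=> a; have [y ay Wy] := Wmeets a; exists y.
Qed.

Lemma join_orbit_top W x y : G_rack R ->
  (orbit_subrack x `|` W = \top)%O -> rack_orbit x y ->
  subrack_set W y -> W = \top%O.
Proof.
move=> hR OW1 xy Wy; apply: G_rack_subrack_top => // a.
have [z az [xz|Wz]] := join_top_meets_orbit a OW1; last by exists z.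
by exists y => //; apply: (rack_orbit_sub az xz).
Qed.

(** Orbits are atoms of the lattice; this is the link between the four properties. The point [x]
    both names the orbit and makes [Q] nonempty. *)
Definition minimal_orbits : Prop := forall x Q,
  subrack_set Q x -> (Q <= orbit_subrack x)%O -> (orbit_subrack x <= Q)%O.

Lemma minimal_orbits_invariant Q : minimal_orbits -> translation_invariant Q.
Proof.
move=> minO.
have subQ x : subrack_set Q x -> rack_orbit x `<=` Q.
  move=> Qx y xy; have /subrack_lP : (orbit_subrack x <= Q `&` orbit_subrack x)%O.
    by apply: minO; [split=> //; apply: rack_orbit_refl|apply: leIr].
  by move=> /(_ _ xy)[].
move=> a x; split=> [/subQ|/subQ]; apply.
  by apply/(translation_invariant_orbit _ a)/rack_orbit_refl.
by apply/translation_invariant_orbit/rack_orbit_refl.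
Qed.

(** * Minimality of orbits from each lattice property *)

Lemma modular_minimal_orbits :
  G_rack R -> modular (subrack R) -> minimal_orbits.
Proof.
move=> hR modR x Q Qx QO.
have CQ1 : (coorbit_subrack x `|` Q = \top)%O.
  apply: G_rack_subrack_top => // a; have [xa|xNa] := pselect (rack_orbit x a).
    exists x; last by apply: (subrack_lP _ _ (leUr _ _)).
    by apply: (rack_orbit_sub (rack_orbit_refl a) xa); apply: rack_orbit_refl.
  by exists a; [apply: rack_orbit_refl|apply: (subrack_lP _ _ (leUl _ _))].
have OC0 : (orbit_subrack x `&` coorbit_subrack x = \bot)%O.
  by apply/eqP/subrack_botP; rewrite meetEsubrack setICr.
by have := modR _ _ (coorbit_subrack x) QO; rewrite CQ1 OC0 meetx1 join0x => ->.
Qed.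

Lemma relatively_complemented_minimal_orbits :
  G_rack R -> relatively_complemented (subrack R) -> minimal_orbits.
Proof.
move=> hR relR x Q Qx QO.
have := relR _ _ (lex1 Q) (orbit_subrack x); rewrite QO lex1.
move=> /(_ isT)[W [/andP[/subrack_lP QW _] OWQ OW1]].
have W1 := join_orbit_top hR OW1 (rack_orbit_refl x) (QW x Qx).
by rewrite -OWQ W1 meetx1.
Qed.

Lemma least_subrack_invariant x A :
  (A <= orbit_subrack x)%O -> A !=set0 ->
  (forall Q, Q !=set0 -> (Q <= orbit_subrack x)%O -> (A <= Q)%O) ->
  translation_invariant A.
Proof.
move=> /subrack_lP AO [y Ay] minA a z.
have /is_subrackE[Aop Adiv] := subrackP A.
have invO := @translation_invariant_orbit x.
split.
  (* The image of [A] under translation by [a] contains [A] by leastness; injectivity then gives the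
     forward implication. *)
  have imP : is_subrack [set a ▷ t | t in subrack_set A].
    apply/is_subrackE; split=> [_ _ [s As <-] [t At <-]|_ t [s As <-]].
      by exists (s ▷ t); [apply: Aop|rewrite rack_opD].
    have [u [<- _]] := rack_op_ex1 a t.
    by rewrite -rack_opD => -[v Av /rack_op_inj vE]; exists u => //;
      apply: (Adiv s); rewrite -?vE.
  have /subrack_lP Aim : (A <= Subrack imP)%O.
    apply: minA; first by exists (a ▷ y), y.
    by apply/subrack_lP => _ [t At <-]; apply/invO/AO.
  by move=> /Aim[t At /rack_op_inj <-].
(* The preimage of [A] contains [A] likewise, which is the converse. *)
have preP : is_subrack [set t | subrack_set A (a ▷ t)].
  apply/is_subrackE; split=> [s t /= As At|s t /= As].
    by rewrite rack_opD; apply: Aop.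
  by rewrite rack_opD; apply: Adiv.
suff /subrack_lP Apre : (A <= Subrack preP)%O by move=> /Apre.
apply: minA; last by apply/subrack_lP => t /= /AO/invO.
by have [t [at_y _]] := rack_op_ex1 a y; exists t; rewrite /= at_y.
Qed.

Lemma orthocomplemented_minimal_orbits :
  G_rack R -> orthocomplemented (subrack R) -> minimal_orbits.
Proof.
move=> hR [_ [phi [phiK phiC phi_anti]]] x.
set O := orbit_subrack x; set C := coorbit_subrack x.
have phiC_least Q : Q !=set0 -> (Q <= O)%O -> (phi C <= Q)%O.
  move=> [q Qq] QO; rewrite -(phiK Q); apply: (phi_anti _ _).
  apply/subrack_lP => y phiQy xy.
  have OphiQ1 : (O `|` phi Q = \top)%O.
    apply: le_anti; rewrite lex1 -(phiC O).2 leUx leUl /=.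
    by apply: le_trans (leUr _ _); apply: phi_anti.
  (* If [phi Q] met [O] it would be the top, and [Q] would be empty. *)
  have [+ _] := phiC Q; rewrite (join_orbit_top hR OphiQ1 xy phiQy) meetx1.
  by move=> /eqP/subrack_botP Q0; rewrite Q0 in Qq.
have [CphiC0 CphiC1] := phiC C.
have phiCO : (phi C <= O)%O.
  apply/subrack_lP => y phiCy; apply: contrapT => xNy.
  move/eqP/subrack_botP: CphiC0; rewrite meetEsubrack.
  by apply/eqP/set0P; exists y.
(* [C] misses the orbit of [x], so [phi C] meets it and is nonempty. *)
have [y xy [//|phiCy]] := join_top_meets_orbit x CphiC1.
have phiC_inv := least_subrack_invariant phiCO (ex_intro _ y phiCy) phiC_least.
have OphiC : (O <= phi C)%O.
  apply/subrack_lP; apply: (subset_trans (rack_orbit_sub (rack_orbit_refl y) xy)).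
  exact: orbit_sub_invariant.
move=> Q Qx QO; apply: le_trans OphiC _.
by apply: phiC_least => //; exists x.
Qed.

(** * Set operations as lattice operations *)

Section UnionsOfOrbits.
Hypothesis minO : minimal_orbits.

Definition compl_subrack A : subrack R :=
  Subrack (translation_invariant_subrack
    (translation_invariantC (@minimal_orbits_invariant A minO))).

(** A union of invariant sets is invariant, hence already a subrack. *)
Lemma join_subrackE A B : (A `|` B)%O = A `|` B :> set R.
Proof.
have invA := @minimal_orbits_invariant A minO.
have invB := @minimal_orbits_invariant B minO.
rewrite joinEsubrack; apply/seteqP; split; last exact: sub_gen_smallest.
apply: smallest_sub => //; apply: translation_invariant_subrack => a x.
by split=> -[]; [move/invA; left|move/invB; right
                |move/(invA a); left|move/(invB a); right].
Qed.

Lemma compl_subrackP A : is_complement A (compl_subrack A).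
Proof.
split; apply: subrack_inj; first by rewrite meetEsubrack setICr.
by rewrite join_subrackE setUv.
Qed.

Lemma subrack_distributive : distributive_lattice (subrack R).
Proof.
move=> A B C; apply: subrack_inj.
by rewrite !(join_subrackE, meetEsubrack) setIUr.
Qed.

Lemma subrack_complemented : complemented (subrack R).
Proof. by move=> A; exists (compl_subrack A); apply: compl_subrackP. Qed.

Lemma subrack_orthocomplemented : orthocomplemented (subrack R).
Proof.
split; first exact: subrack_complemented.
exists compl_subrack; split=> [A|A|A B /subrack_lP AB].
- by apply: subrack_inj; rewrite /= setCK.
- exact: compl_subrackP.
- by apply/subrack_lP; apply: subsetC.
Qed.

End UnionsOfOrbits.
End Orbits.

(** * General lattice implications *)

Section LatticeFacts.
Context {d : Order.disp_t} (L : tbLatticeType d).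
Local Open Scope order_scope.

Lemma distributive_modular : distributive_lattice L -> modular L.
Proof. by move=> distL a b c /meet_idPr ba; rewrite distL ba. Qed.

Lemma boolean_relatively_complemented :
  boolean_algebra L -> relatively_complemented L.
Proof.
move=> [compL distL] x y xy z /andP[xz zy].
have modL := distributive_modular distL.
(* The complement [z'] is pushed into the interval; the modular law verifies the meet and the
   join. *)
have [z' [zz'0 zz'1]] := compL z; exists (y `&` (z' `|` x)); split.
- by rewrite lexI xy leUr leIl.
- by rewrite meetA (meet_l zy) (modL _ _ _ xz) zz'0 join0x.
- by rewrite joinC -(modL _ _ _ zy) -joinA (join_r xz) joinC zz'1 meetx1.
Qed.

End LatticeFacts.

Theorem theorem4p4 (R : rackType) (hR : G_rack R) :
  [<-> boolean_algebra (subrack R);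
       modular (subrack R);
       relatively_complemented (subrack R);
       orthocomplemented (subrack R)].
Proof.
tfae=> [[_]|modR|relR|ortR].
- exact: distributive_modular.
(* Relative complements are obtained by way of the Boolean structure. *)
- have minO := modular_minimal_orbits hR modR.
  apply: boolean_relatively_complemented.
  by split; [apply: subrack_complemented|apply: subrack_distributive].
- exact/subrack_orthocomplemented/relatively_complemented_minimal_orbits.
- have minO := orthocomplemented_minimal_orbits hR ortR.
  by split; [apply: subrack_complemented|apply: subrack_distributive].
Qed.
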